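(* Let $1 \le d \le D$ be integers and let $\mathcal{L} \subseteq \mathbb{R}^D$ be a $d$-dimensional affine subspace (viewed as an embedded submanifold of $\mathbb{R}^D$). Let $X$ be a random vector in $\mathbb{R}^D$ whose distribution is supported on $\mathcal{L}$ and has a density $p$ with respect to the $d$-dimensional Lebesgue measure on $\mathcal{L}$, where $p$ is continuous and the distribution has finite second moments. For $\delta \in \mathbb{R}$ and $x \in \mathbb{R}^D$ define $$\varrho(x,\delta) \;=\; \int p(x_0)\, \mathcal{N}\!\left(x - x_0;\, 0,\, e^{2\delta} I_D\right) \mathrm{d}x_0,$$ the integral being over $\mathcal{L}$ with respect to its $d$-dimensional Lebesgue measure, i.e. $\varrho(\cdot,\delta)$ is the Lebesgue density on $\mathbb{R}^D$ of $X + e^{\delta} Z$ with $Z \sim \mathcal{N}(0, I_D)$ independent of $X$. Then for every $x \in \mathcal{L}$ with $p(x) > 0$, $$\lim_{\delta \to -\infty} \frac{\partial}{\partial \delta} \log \varrho(x,\delta) \;=\; d - D.$$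
   Context: $\mathcal{N}(y; \mu, \Sigma)$ denotes the Gaussian density with mean $\mu$ and covariance $\Sigma$ evaluated at $y$, and $I_D$ is the $D\times D$ identity matrix. The paper writes the data density as $p(\cdot,0)$ and, with an abuse of notation, identifies it with the density of the data with respect to $d$-dimensional Lebesgue measure on $\mathcal{L}$. *)

(* Defs.v *)
From HB Require Import structures.
From mathcomp Require Import all_boot all_order all_algebra.
From mathcomp Require Import all_classical all_reals all_analysis.
Set Implicit Arguments. Unset Strict Implicit. Unset Printing Implicit Defensive.
Import Order.TTheory GRing.Theory Num.Theory.
Import numFieldNormedType.Exports.
Local Open Scope classical_set_scope.
Local Open Scope ring_scope.

Section Defs.
Variable R : realType.

(* Integral w.r.t. n-dimensional Lebesgue measure on R^n = 'rV[R]_n of an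
   extended-real valued function, defined as the iterated one-dimensional
   Lebesgue integral (for the nonnegative measurable integrands used here this
   is the integral w.r.t. the n-fold product Lebesgue measure, by Tonelli). *)
Fixpoint lebint (n : nat) : ('rV[R]_n -> \bar R) -> \bar R :=
  match n with
  | 0 => fun f => f 0
  | n'.+1 => fun f =>
      (\int[@lebesgue_measure R]_(t in [set: R])
         lebint (fun v : 'rV[R]_n' => f (row_mx (\row_(j < 1) t) v)))%E
  end.

Definition sqnorm (D : nat) (y : 'rV[R]_D) : R := \sum_(i < D) y 0 i ^+ 2.

Definition gauss (D : nat) (delta : R) (y : 'rV[R]_D) : R :=
  ((Num.sqrt (2 * pi) * expR delta) ^+ D)^-1
  * expR (- sqnorm y / (2 * expR (2 * delta))).

(* The d-dimensional affine subspace L = { a + u U | u in R^d } of R^D, where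
   the rows of U : 'M_(d,D) are orthonormal (U U^T = I_d). *)
Definition affsub (d D : nat) (a : 'rV[R]_D) (U : 'M[R]_(d, D)) : set 'rV[R]_D :=
  [set a + u *m U | u in [set: 'rV[R]_d]].

(* Integral over L w.r.t. its d-dimensional Lebesgue measure, i.e. the
   pushforward of Lebesgue measure on R^d under the isometric parametrization
   u |-> a + u U. *)
Definition Lint (d D : nat) (a : 'rV[R]_D) (U : 'M[R]_(d, D))
  (g : 'rV[R]_D -> \bar R) : \bar R :=
  lebint (fun u : 'rV[R]_d => g (a + u *m U)).

Definition rho (d D : nat) (a : 'rV[R]_D) (U : 'M[R]_(d, D))
  (p : 'rV[R]_D -> R) (x : 'rV[R]_D) (delta : R) : R :=
  fine (Lint a U (fun x0 => (p x0 * gauss delta (x - x0))%:E)).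

End Defs.

(* Main.v *)
(** Write q(u) = p(a + uU), x = a + u0 U and r(u) = |u - u0|^2, and let
    F_q(b) be the integral of q exp(-b r) over R^d. Since U is an isometry,
    rho(x, delta) = (sqrt(2 pi) e^delta)^(-D) F_q(b) with b = e^(-2 delta) / 2,
    and F_q' = - F_(q r), so d/ddelta log rho = - D + 2 b F_(q r)(b) / F_q(b).
    The kernel concentrates at u0 as b -> +oo, so F_q ~ q(u0) F_1 and
    F_(q r) ~ q(u0) F_r. Finally F_1 = (sqrt(2 pi) e^delta)^d, whose derivative
    in delta gives 2 b F_r = d F_1, hence the limit d - D. *)
Require Import Defs.
From HB Require Import structures.
From mathcomp Require Import all_boot all_order all_algebra.
From mathcomp Require Import all_classical all_reals all_analysis.
From mathcomp Require Import measurable_realfun ring lra.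
Set Implicit Arguments. Unset Strict Implicit. Unset Printing Implicit Defensive.
Import Order.TTheory GRing.Theory Num.Theory.
Import numFieldNormedType.Exports.
Local Open Scope classical_set_scope.
Local Open Scope ring_scope.

(** * Iterated integrals of nonnegative continuous functions *)

Section lebint_theory.
Context {R : realType}.

Local Notation row_cons t v := (row_mx (\row_(j < 1) t) v).

Lemma row_cons_ball n (t t' e : R) (v v' : 'rV[R]_n) :
  ball t e t' -> ball v e v' -> ball (row_cons t v) e (row_cons t' v').
Proof.
move=> tt' [e0 vv']; split => // i j.
by rewrite !mxE; case: splitP => k _; rewrite ?mxE.
Qed.

Lemma continuous_row_consr n (f : 'rV[R]_(1 + n) -> R) (t : R) :
  continuous f -> continuous (fun v : 'rV[R]_n => f (row_cons t v)).
Proof.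
move=> cf v; apply: (@continuous_comp _ _ _ (fun v : 'rV[R]_n => row_cons t v) f);
  last exact: cf.
move=> A /= /nbhs_ballP[e e0 eA]; apply/nbhs_ballP; exists e => // v' vv'.
by apply: eA; apply: row_cons_ball => //; exact: ballxx.
Qed.

Lemma continuous_row_consl n (f : 'rV[R]_(1 + n) -> R) (v : 'rV[R]_n) :
  continuous f -> continuous (fun t : R => f (row_cons t v)).
Proof.
move=> cf t; apply: (@continuous_comp _ _ _ (fun t : R => row_cons t v) f); last exact: cf.
move=> A /= /nbhs_ballP[e e0 eA]; apply/nbhs_ballP; exists e => // t' tt'.
by apply: eA; apply: row_cons_ball => //; exact: ballxx.
Qed.

Lemma lebint_ge0 n (f : 'rV[R]_n -> R) :
  (forall v, 0 <= f v) -> (0 <= lebint (EFin \o f))%E.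
Proof.
elim: n f => [|n IH] f f0 /=; first by rewrite lee_fin.
by apply: integral_ge0 => t _; apply: IH.
Qed.

Lemma limn_einf_le_cst (u : (\bar R)^nat) (c : \bar R) :
  (forall k, (u k <= c)%E) -> (limn_einf u <= c)%E.
Proof.
move=> uc; rewrite limn_einf_lim; apply: lime_le; first exact: is_cvg_einfs.
apply: nearW => k; apply: le_trans (uc k).
by apply: ereal_inf_lbound; exists k => /=.
Qed.

(** Isolated as a predicate of the dimension so that measurability in dimension n + 1 can be drawn
    from it inside the induction that proves it. Asking for continuous functions makes every slice
    again admissible. *)
Definition lebint_fatou_at n := forall (f_ : nat -> 'rV[R]_n -> R) (f : 'rV[R]_n -> R),
  (forall k, continuous (f_ k)) -> (forall k v, 0 <= f_ k v) ->
  continuous f -> (forall v, 0 <= f v) ->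
  (forall v, f_ ^~ v @ \oo --> f v) ->
  (lebint (EFin \o f) <= limn_einf (fun k => lebint (EFin \o f_ k)))%E.

(* Fatou along sequences t_k -> t makes the inner integral lower semicontinuous
   in t; dimension n of Fatou thus yields the measurability that dimension
   n + 1 needs. *)
Lemma measurable_lebint_of_fatou n : lebint_fatou_at n ->
  forall f : 'rV[R]_(1 + n) -> R, continuous f -> (forall v, 0 <= f v) ->
  measurable_fun [set: R]
    ((fun t => lebint (fun v : 'rV[R]_n => (f (row_cons t v))%:E)) : R -> \bar R).
Proof.
move=> fatou_n f cf f0; apply: lower_semicontinuous_measurable => t a aft.
apply: contrapT => noV.
have tk k : exists t', ball t k.+1%:R^-1 t' /\
    (lebint (fun v : 'rV[R]_n => (f (row_cons t' v))%:E) <= a%:E)%E.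
  apply: contrapT => nt; apply: noV; exists (ball t k.+1%:R^-1).
    by apply: nbhsx_ballx; rewrite invr_gt0.
  by move=> y ty; rewrite ltNge; apply/negP => ya; apply: nt; exists y.
have [s sP] := choice tk.
have st : s @ \oo --> t.
  apply/cvg_ballP => e e0; near=> k.
  apply: le_ball (sP k).1; apply: ltW; near: k.
  exact: (near_infty_natSinv_lt (PosNum e0)).
have : (lebint (fun v : 'rV[R]_n => (f (row_cons t v))%:E) <= a%:E)%E.
  have Hf := fatou_n (fun k v => f (row_cons (s k) v)) (fun v => f (row_cons t v)).
  apply: le_trans (Hf _ _ _ _ _) _.
  - by move=> k; apply: continuous_row_consr.
  - by move=> *; apply: f0.
  - exact: continuous_row_consr.
  - by move=> *; apply: f0.
  - move=> v; apply: (@cvg_comp _ _ _ s (fun t => f (row_cons t v)) _ (nbhs t)) => //.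
    exact: (@continuous_row_consl n f v cf t).
  - by apply: limn_einf_le_cst => k; exact: (sP k).2.
by rewrite leNgt aft.
Unshelve. all: by end_near. Qed.

(** Induction on the dimension: the inductive hypothesis on each slice bounds the inner integral of
    the limit, and one-dimensional Fatou then moves the lower limit out of the outer integral. *)
Lemma lebint_fatou n : lebint_fatou_at n.
Proof.
elim: n => [|n IH] f_ f cf_ f_0 cf f0 fcvg /=.
  have /cvg_limn_einf_sup[-> _] : (f_ k 0)%:E @[k --> \oo] --> (f 0)%:E.
    by apply/fine_cvgP; split; [exact: nearW | exact: fcvg].
  exact: lexx.
have mL := measurable_lebint_of_fatou IH.
apply: le_trans (fatou _ _ _ _) => //=.
- apply: ge0_le_integral => //.
  + by move=> t _; apply: (lebint_ge0 (f := fun v => f (row_cons t v))).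
  + exact: mL.
  (* A lower limit is the opposite of the upper limit of the opposites, which reduces the goal to
     measurability of an upper limit. *)
  + apply: measurableT_comp => //.
    apply: measurable_fun_limn_esup => k; apply: measurableT_comp => //; exact: mL.
  + move=> t _.
    apply: (IH (fun k v => f_ k (row_cons t v)) (fun v => f (row_cons t v))) => // *.
    * exact: continuous_row_consr.
    * exact: continuous_row_consr.
- by move=> k; exact: mL.
- by move=> k t _; apply: (lebint_ge0 (f := fun v => f_ k (row_cons t v))).
Qed.

Lemma measurable_lebint n (f : 'rV[R]_(1 + n) -> R) :
  continuous f -> (forall v, 0 <= f v) ->
  measurable_fun [set: R]
    ((fun t => lebint (fun v : 'rV[R]_n => (f (row_cons t v))%:E)) : R -> \bar R).
Proof. exact: measurable_lebint_of_fatou (@lebint_fatou n) f. Qed.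

Lemma lebintD n (f g : 'rV[R]_n -> R) :
  continuous f -> (forall v, 0 <= f v) -> continuous g -> (forall v, 0 <= g v) ->
  (lebint (fun v => (f v + g v)%:E) =
   lebint (EFin \o f) + lebint (EFin \o g))%E.
Proof.
elim: n f g => [|n IH] f g cf f0 cg g0 /=; first by rewrite EFinD.
rewrite -ge0_integralD //=.
- apply: eq_integral => t _.
  apply: (IH (fun v => f (row_cons t v)) (fun v => g (row_cons t v))) => // *;
    exact: continuous_row_consr.
- by move=> t _; apply: (lebint_ge0 (f := fun v => f (row_cons t v))).
- exact: measurable_lebint.
- by move=> t _; apply: (lebint_ge0 (f := fun v => g (row_cons t v))).
- exact: measurable_lebint.
Qed.

Lemma lebintZ n (c : R) (f : 'rV[R]_n -> R) :
  0 <= c -> continuous f -> (forall v, 0 <= f v) ->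
  (lebint (fun v => (c * f v)%:E) = c%:E * lebint (EFin \o f))%E.
Proof.
move=> c0; elim: n f => [|n IH] f cf f0 /=; first by rewrite EFinM.
rewrite -ge0_integralZl_EFin //=.
- apply: eq_integral => t _.
  by apply: (IH (fun v => f (row_cons t v))) => //; exact: continuous_row_consr.
- by move=> t _; apply: (lebint_ge0 (f := fun v => f (row_cons t v))).
- exact: measurable_lebint.
Qed.

Lemma le_lebint n (f g : 'rV[R]_n -> R) :
  continuous f -> (forall v, 0 <= f v) -> continuous g ->
  (forall v, f v <= g v) ->
  (lebint (EFin \o f) <= lebint (EFin \o g))%E.
Proof.
elim: n f g => [|n IH] f g cf f0 cg fg /=; first by rewrite lee_fin.
have g0 v : 0 <= g v by apply: le_trans (f0 v) (fg v).
apply: ge0_le_integral => //.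
- by move=> t _; apply: (lebint_ge0 (f := fun v => f (row_cons t v))).
- exact: measurable_lebint.
- exact: measurable_lebint.
- move=> t _.
  apply: (IH (fun v => f (row_cons t v)) (fun v => g (row_cons t v))) => //;
    exact: continuous_row_consr.
Qed.

End lebint_theory.

(** * Finite integrals as real numbers *)

Section real_lebint.
Context {R : realType}.
Implicit Types n : nat.

(** Continuity stands in for measurability: it passes to slices and makes every inner integral of
    [lebint] measurable. *)
Definition nnc_integrable n (f : 'rV[R]_n -> R) :=
  [/\ continuous f, (forall v, 0 <= f v) & (lebint (EFin \o f) < +oo)%E].

(** [fine] sends an infinite integral to 0, so the value is meaningful only together with
    [nnc_integrable]. *)
Definition rlebint n (f : 'rV[R]_n -> R) : R := fine (lebint (EFin \o f)).

Lemma rlebintK n (f : 'rV[R]_n -> R) : nnc_integrable f ->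
  lebint (EFin \o f) = (rlebint f)%:E.
Proof. by move=> [_ f0 foo]; rewrite fineK // ge0_fin_numE // lebint_ge0. Qed.

Lemma rlebint_ge0 n (f : 'rV[R]_n -> R) : (forall v, 0 <= f v) -> 0 <= rlebint f.
Proof. by move=> f0; apply/fine_ge0/lebint_ge0. Qed.

Lemma nnc_integrableD n (f g : 'rV[R]_n -> R) : nnc_integrable f -> nnc_integrable g ->
  nnc_integrable (fun v => f v + g v).
Proof.
move=> [cf f0 foo] [cg g0 goo]; split.
- by move=> v; exact: (cvgD (cf v) (cg v)).
- by move=> v; apply: addr_ge0.
- by rewrite lebintD // lte_add_pinfty.
Qed.

Lemma rlebintD n (f g : 'rV[R]_n -> R) : nnc_integrable f -> nnc_integrable g ->
  rlebint (fun v => f v + g v) = rlebint f + rlebint g.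
Proof.
move=> If Ig; apply: EFin_inj.
rewrite EFinD -!rlebintK //; last exact: nnc_integrableD.
by case: If Ig => ? ? ? [? ? ?]; exact: lebintD.
Qed.

Lemma nnc_integrableZ n (c : R) (f : 'rV[R]_n -> R) : 0 <= c -> nnc_integrable f ->
  nnc_integrable (fun v => c * f v).
Proof.
move=> c0 If; have [cf f0 foo] := If; split.
- by move=> v; exact: (cvgM (cvg_cst c) (cf v)).
- by move=> v; apply: mulr_ge0.
- by rewrite lebintZ // rlebintK // -EFinM ltry.
Qed.

Lemma rlebintZ n (c : R) (f : 'rV[R]_n -> R) : 0 <= c -> nnc_integrable f ->
  rlebint (fun v => c * f v) = c * rlebint f.
Proof.
move=> c0 If; apply: EFin_inj.
rewrite EFinM -!rlebintK //; last exact: nnc_integrableZ.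
by case: If => ? ? ?; exact: lebintZ.
Qed.

Lemma nnc_integrable_le n (f g : 'rV[R]_n -> R) : continuous f ->
  (forall v, 0 <= f v) -> (forall v, f v <= g v) -> nnc_integrable g -> nnc_integrable f.
Proof.
move=> cf f0 fg [cg g0 goo]; split => //.
by apply: le_lt_trans goo; apply: le_lebint.
Qed.

Lemma le_rlebint n (f g : 'rV[R]_n -> R) : nnc_integrable f -> nnc_integrable g ->
  (forall v, f v <= g v) -> rlebint f <= rlebint g.
Proof.
move=> If Ig fg; rewrite -lee_fin -!rlebintK //.
by case: If Ig => ? ? ? [? ? ?]; apply: le_lebint.
Qed.

End real_lebint.

(** * Gaussian transforms *)

Section gauss_transform.
Context {R : realType} (n : nat) (u0 : 'rV[R]_n).
Implicit Types (q w : 'rV[R]_n -> R) (b h : R).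

Local Notation r2 := (fun v : 'rV[R]_n => sqnorm (v - u0)).

Lemma sqnorm_ge0 (v : 'rV[R]_n) : 0 <= sqnorm v.
Proof. by apply: sumr_ge0 => i _; exact: sqr_ge0. Qed.

Lemma continuous_r2 : continuous r2.
Proof.
apply: continuous_big => [|i _ v]; first exact: add_continuous.
apply: (@cvg_comp _ _ _ (fun v : 'rV[R]_n => (v - u0) 0 i) (fun y => y ^+ 2) _
  (nbhs ((v - u0) 0 i)));
  last exact: exprn_continuous.
apply: (@cvg_comp _ _ _ (fun v : 'rV[R]_n => v - u0) (fun v => v 0 i) _ (nbhs (v - u0)));
  last exact: coord_continuous.
exact: (cvgB cvg_id (cvg_cst u0)).
Qed.

Definition gker b (v : 'rV[R]_n) : R := expR (- (b * sqnorm (v - u0))).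

Lemma continuous_gker b : continuous (gker b).
Proof.
move=> v.
apply: (@cvg_comp _ _ _ (fun v : 'rV[R]_n => - (b * sqnorm (v - u0))) expR _
  (nbhs (- (b * sqnorm (v - u0))))); last exact: continuous_expR.
exact: (cvgN (cvgM (cvg_cst b) (@continuous_r2 v))).
Qed.

(* The density q is integrable, but the constant 1 and sqnorm (_ - u0) are only
   integrable against Gaussian kernels. *)
Definition tempered q := [/\ continuous q, (forall v, 0 <= q v) &
  forall b, 0 < b -> nnc_integrable (fun v => q v * gker b v)].

(** As a function of [b], the Laplace transform of the image of the measure q(v) dv under the
    squared distance to [u0]. *)
Definition gtransf q b : R := rlebint (fun v => q v * gker b v).

Lemma gtransf_ge0 q b : tempered q -> 0 <= gtransf q b.
Proof. by case=> _ q0 _; apply: rlebint_ge0 => v; rewrite mulr_ge0 ?expR_ge0. Qed.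

Lemma continuousM_gker q b : continuous q -> continuous (fun v => q v * gker b v).
Proof. by move=> cq v; exact: (cvgM (cq v) (@continuous_gker b v)). Qed.

Lemma tempered_nnc_integrable q : nnc_integrable q -> tempered q.
Proof.
move=> Iq; have [cq q0 _] := Iq; split => // b b0.
apply: nnc_integrable_le Iq => // [|v|v]; first exact: continuousM_gker.
  by rewrite mulr_ge0 ?expR_ge0.
by rewrite ler_piMr // -expR0 ler_expR oppr_le0 mulr_ge0 ?sqnorm_ge0 ?ltW.
Qed.

(** Half of the exponent absorbs the new factor: 1 + x <= e^x at x = b r / 2 gives r e^(-b r / 2) <=
    2 / b, and the other half is the kernel at b / 2. *)
Lemma temperedM_r2 q : tempered q -> tempered (fun v => q v * r2 v).
Proof.
move=> [cq q0 Iq]; have cqr : continuous (fun v => q v * r2 v).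
  by move=> v; exact: (cvgM (cq v) (@continuous_r2 v)).
split => // [v|b b0]; first by rewrite mulr_ge0 ?sqnorm_ge0.
have b20 : 0 < b / 2 by rewrite divr_gt0.
apply: (nnc_integrable_le _ _ _ (nnc_integrableZ (c := 2 / b) _ (Iq _ b20))) => [|v|v|].
- exact: continuousM_gker.
- by rewrite !mulr_ge0 ?expR_ge0 ?sqnorm_ge0.
- rewrite mulrCA -mulrA ler_wpM2l //.
  have -> : gker b v = gker (b / 2) v * gker (b / 2) v.
    by rewrite /gker -expRD; congr expR; field.
  rewrite mulrA ler_wpM2r ?expR_ge0 //.
  rewrite /gker expRN ler_pdivrMr ?expR_gt0 //.
  rewrite -ler_pdivrMl ?divr_gt0 // invf_div.
  by apply: le_trans (expR_ge1Dx _); rewrite lerDr.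
- by rewrite divr_ge0 ?ltW.
Qed.

Lemma temperedD q w : tempered q -> tempered w -> tempered (fun v => q v + w v).
Proof.
move=> [cq q0 Iq] [cw w0 Iw]; split.
- by move=> v; exact: (cvgD (cq v) (cw v)).
- by move=> v; apply: addr_ge0.
move=> b b0; under [X in nnc_integrable X]eq_fun do rewrite mulrDl.
by apply: nnc_integrableD; auto.
Qed.

Lemma temperedZ q (c : R) : 0 <= c -> tempered q -> tempered (fun v => c * q v).
Proof.
move=> c0 [cq q0 Iq]; split.
- by move=> v; exact: (cvgM (cvg_cst c) (cq v)).
- by move=> v; apply: mulr_ge0.
move=> b b0; under [X in nnc_integrable X]eq_fun do rewrite -mulrA.
by apply: nnc_integrableZ; auto.
Qed.

(** Only the tangent-line inequality at z and -z is used: e^z (1 - z) <= 1 gives e^z - 1 - z <= z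
    (e^z - 1), and the same inequalities bound e^z - 1, with a case split on the sign of z. *)
Lemma expR_quadratic_bound (z : R) : 0 <= expR z - 1 - z <= z ^+ 2 * expR `|z|.
Proof.
have e1 := expR_ge1Dx z; have e2 := expR_ge1Dx (- z).
have ez := expR_gt0 z.
have e3 : expR z * (1 - z) <= 1.
  by have := expRxMexpNx_1 z; nra.
apply/andP; split; first by lra.
have [z0|z0] := ger0P z; first by nra.
have e4 : 1 <= expR (- z) by lra.
have : z ^+ 2 <= z ^+ 2 * expR (- z) by rewrite ler_peMr ?sqr_ge0.
nra.
Qed.

(** With z = - h r, the kernel at b + h is the kernel at b times e^z, so this is the second-order
    expansion of e^z. Since |z| <= b r / 2, the factor e^|z| in the remainder costs half of the
    decay, whence the kernel at b / 2. *)
Lemma gker_quadratic_bound b h v : 0 < b -> `|h| <= b / 2 ->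
  gker b v <= gker (b + h) v + h * (r2 v * gker b v)
  <= gker b v + h ^+ 2 * (r2 v * r2 v * gker (b / 2) v).
Proof.
move=> b0 hb; have r0 := sqnorm_ge0 (v - u0).
have := expR_quadratic_bound (- (h * sqnorm (v - u0))).
set r := sqnorm _ in r0 *; set z := - (h * r) => /andP[z1 z2].
have -> : gker (b + h) v = gker b v * expR z.
  by rewrite /gker -expRD; congr expR; rewrite /z /r; ring.
have k0 : 0 <= gker b v by exact: expR_ge0.
have -> : gker b v * expR z + h * (r * gker b v) =
  gker b v + gker b v * (expR z - 1 - z) by rewrite /z; ring.
rewrite lerDl mulr_ge0 //= lerD2l.
apply: le_trans (ler_wpM2l k0 z2) _.
have -> : gker b v * (z ^+ 2 * expR `|z|) = h ^+ 2 * (r * r * (gker b v * expR `|z|)).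
  by rewrite /z; ring.
rewrite ler_wpM2l ?sqr_ge0 // ler_wpM2l ?mulr_ge0 //.
rewrite /gker -expRD ler_expR -/r normrN normrM (ger0_norm r0).
nra.
Qed.

(** The pointwise expansion is integrated term by term. An explicit quadratic remainder replaces
    dominated convergence in the differentiation under the integral sign. *)
Lemma gtransf_quadratic_bound q b h : tempered q -> 0 < b -> `|h| <= b / 2 ->
  `|gtransf q (b + h) - gtransf q b + h * gtransf (fun v => q v * r2 v) b|
  <= h ^+ 2 * gtransf (fun v => q v * r2 v * r2 v) (b / 2).
Proof.
move=> Tq b0 hb; have Tq2 := temperedM_r2 Tq; have Tq4 := temperedM_r2 Tq2.
have [hb1 hb2] : - (b / 2) <= h /\ h <= b / 2 by apply/andP; rewrite -ler_norml.
have bh0 : 0 < b + h by lra.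
have b20 : 0 < b / 2 by lra.
have [_ q0 Iq] := Tq; have [_ _ Iq2] := Tq2; have [_ _ Iq4] := Tq4.
rewrite /gtransf.
set A := (fun v => q v * gker (b + h) v); set B := (fun v => q v * gker b v).
set C := (fun v => q v * r2 v * gker b v).
set E := (fun v => q v * r2 v * r2 v * gker (b / 2) v).
have IA : nnc_integrable A by exact: Iq.
have IB : nnc_integrable B by exact: Iq.
have IC : nnc_integrable C by exact: Iq2.
have IE : nnc_integrable E by exact: Iq4.
have key v : B v <= A v + h * C v <= B v + h ^+ 2 * E v.
  have /andP[k1 k2] := gker_quadratic_bound v b0 hb.
  have := ler_wpM2l (q0 v) k1; have := ler_wpM2l (q0 v) k2.
  by rewrite /A /B /C /E !mulrDr => *; apply/andP; split; lra.
have h20 : 0 <= h ^+ 2 by exact: sqr_ge0.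
have IhE : nnc_integrable (fun v => h ^+ 2 * E v) by exact: nnc_integrableZ.
(* The integral is linear here only for nonnegative coefficients, so for negative [h] the
   first-order term is moved across the inequality with coefficient - h. *)
have [h0|h0] := leP 0 h.
  have IhC : nnc_integrable (fun v => h * C v) by exact: nnc_integrableZ.
  have l1 : rlebint B <= rlebint A + h * rlebint C.
    rewrite -rlebintZ // -rlebintD //.
    by apply: le_rlebint => // [|v]; [exact: nnc_integrableD|have /andP[] := key v].
  have l2 : rlebint A + h * rlebint C <= rlebint B + h ^+ 2 * rlebint E.
    rewrite -!rlebintZ // -!rlebintD //.
    apply: le_rlebint => // [||v]; [exact: nnc_integrableD|exact: nnc_integrableD|].
    by have /andP[] := key v.
  rewrite ger0_norm; lra.
have h0' : 0 <= - h by lra.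
have IhC : nnc_integrable (fun v => - h * C v) by exact: nnc_integrableZ.
have l1 : rlebint B + - h * rlebint C <= rlebint A.
  rewrite -rlebintZ // -rlebintD //.
  apply: le_rlebint => // [|v]; first exact: nnc_integrableD.
  by have /andP[] := key v; lra.
have l2 : rlebint A <= (rlebint B + - h * rlebint C) + h ^+ 2 * rlebint E.
  rewrite -!rlebintZ // -!rlebintD //; last exact: nnc_integrableD.
  apply: le_rlebint => // [|v]; first by do 2?apply: nnc_integrableD.
  by have /andP[] := key v; lra.
rewrite ger0_norm; lra.
Qed.

End gauss_transform.

(** * Derivatives in delta and the Gaussian normalisation *)

Section laplace.
Context {R : realType}.
Implicit Types (b c h delta : R).

(** After division by [h] the error is at most |h| |C|, which tends to 0. *)
Lemma is_derive_quadratic (f : R -> R) (x l c C : R) : 0 < c ->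
  (forall h, `|h| <= c -> `|f (x + h) - f x - h * l| <= h ^+ 2 * C) ->
  is_derive x 1 f l.
Proof.
move=> c0 fxh; have C1 : 0 < `|C| + 1 by rewrite ltr_wpDl.
have fl : h^-1 *: ((f \o shift x) (h *: 1) - f x) @[h --> 0^'] --> l.
  apply/cvgrPdist_le => e e0; near=> h.
  have h0 : h != 0 by near: h; exact: nbhs_dnbhs_neq.
  (* Adding 1 to |C| keeps the denominator positive even when C = 0. *)
  have hc : `|h| <= Num.min c (e / (`|C| + 1)).
    by near: h; apply: dnbhs0_le; rewrite lt_min c0 divr_gt0.
  move: hc; rewrite le_min => /andP[hc he].
  have -> : l - h^-1 *: ((f \o shift x) (h *: 1) - f x) =
      - (h^-1 * (f (x + h) - f x - h * l)).
    by rewrite /= /GRing.scale /= mulr1 [h + x]addrC; field.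
  rewrite normrN normrM normfV ler_pdivrMl ?normr_gt0 //.
  apply: le_trans (fxh h hc) _.
  rewrite -real_normK ?num_real // expr2 -mulrA ler_wpM2l //.
  move: he; rewrite ler_pdivlMr // => he; apply: le_trans he.
  by rewrite ler_wpM2l // (le_trans (ler_norm _)) // lerDl.
apply: DeriveDef; first by apply/cvg_ex; exists l.
exact: cvg_lim.
Unshelve. all: by end_near. Qed.

Lemma is_derive_gtransf n (u0 : 'rV[R]_n) q b : tempered u0 q -> 0 < b ->
  is_derive b 1 (gtransf u0 q)
    (- gtransf u0 (fun v => q v * sqnorm (v - u0)) b).
Proof.
move=> Tq b0; apply: (@is_derive_quadratic _ _ _ (b / 2)
  (gtransf u0 (fun v => q v * sqnorm (v - u0) * sqnorm (v - u0)) (b / 2))) => [|h hb].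
  by rewrite divr_gt0.
by rewrite mulrN opprK; exact: gtransf_quadratic_bound.
Qed.

(* 1 / (2 sigma ^ 2) for the standard deviation sigma = expR delta. *)
Definition prec delta : R := expR (- (2 * delta)) / 2.

Lemma prec_gt0 delta : 0 < prec delta.
Proof. by rewrite divr_gt0 ?expR_gt0. Qed.

Lemma is_derive_prec delta : is_derive delta 1 prec (- (2 * prec delta)).
Proof.
have H : is_derive delta 1 (fun t : R => - (2 * t)) (- 2).
  by apply: is_derive_eq; rewrite /GRing.scale /= mulr1.
have H2 := @is_derive1_comp _ expR (fun t : R => - (2 * t)) _ _ _ (is_derive_expR _) H.
have precE : prec = (2^-1 : R) \*: (expR \o (fun t => - (2 * t))).
  by apply/funext => t; rewrite /prec /GRing.scale /= mulrC.
rewrite [X in is_derive _ _ X]precE; apply: is_derive_eq.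
by rewrite /prec /GRing.scale /=; field.
Qed.

Lemma is_derive_gtransf_prec n (u0 : 'rV[R]_n) q delta : tempered u0 q ->
  is_derive delta 1 (gtransf u0 q \o prec)
    (2 * prec delta * gtransf u0 (fun v => q v * sqnorm (v - u0)) (prec delta)).
Proof.
move=> Tq; have H := is_derive1_comp (is_derive_gtransf Tq (prec_gt0 delta))
  (is_derive_prec delta).
by apply: is_derive_eq; ring.
Qed.

Lemma sqnorm_row_cons n (t : R) (v : 'rV[R]_n) (u0 : 'rV[R]_(1 + n)) :
  sqnorm (row_mx (\row_(j < 1) t) v - u0) =
  (t - u0 0 0) ^+ 2 + sqnorm (v - rsubmx u0).
Proof.
rewrite /sqnorm big_split_ord /= big_ord1 !mxE.
congr (_ + _).
  rewrite (unsplitK (inl 0)) mxE; congr ((_ - u0 _ _) ^+ 2).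
  exact: val_inj.
by apply: eq_bigr => i _; rewrite !mxE (unsplitK (inr i)).
Qed.

(** The integral of the unnormalised one-dimensional Gaussian of standard deviation [expR delta]. *)
Definition gauss_norm delta : R := Num.sqrt (2 * pi) * expR delta.

Lemma gauss_norm_gt0 delta : 0 < gauss_norm delta.
Proof. by rewrite mulr_gt0 ?expR_gt0 // sqrtr_gt0 mulr_gt0 // pi_gt0. Qed.

Lemma is_derive_gauss_normX n delta :
  is_derive delta 1 (fun t => gauss_norm t ^+ n) (n%:R * gauss_norm delta ^+ n).
Proof.
have Hg : is_derive delta 1 gauss_norm (gauss_norm delta).
  have He := is_derive_expR delta.
  by have := @is_deriveZ _ _ _ _ (Num.sqrt (2 * pi)) _ _ _ He.
have -> : (fun t => gauss_norm t ^+ n) = gauss_norm ^+ n.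
  by apply/funext => t; rewrite fctE.
apply: is_derive_eq; rewrite /GRing.scale /=.
case: n => [|n]; first by rewrite !mulr0n !mul0r.
by rewrite exprS -mulr_natl /=; ring.
Qed.

(** The kernel factors over coordinates along the recursion of [lebint]: each outer integral is a
    multiple of [normal_pdf], of total mass 1, and contributes one factor [gauss_norm delta]. *)
Lemma lebint_gker n (u0 : 'rV[R]_n) delta :
  lebint (EFin \o gker u0 (prec delta)) = (gauss_norm delta ^+ n)%:E.
Proof.
elim: n u0 => [|n IH] u0 /=.
  by rewrite /gker /sqnorm big_ord0 mulr0 oppr0 expR0.
have e0 : expR delta != 0 by rewrite gt_eqF // expR_gt0.
have peak : normal_peak (expR delta) = (gauss_norm delta)^-1.
  rewrite /normal_peak /gauss_norm; congr (_^-1).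
  rewrite -mulrnAr sqrtrM ?sqr_ge0 // sqrtr_sqr ger0_norm ?expR_ge0 // mulrC.
  by rewrite mulr_natl.
have gn0 : gauss_norm delta != 0 by rewrite gt_eqF // gauss_norm_gt0.
transitivity (\int[@lebesgue_measure R]_t
   ((gauss_norm delta ^+ n.+1)%:E * (normal_pdf (u0 0 0) (expR delta) t)%:E))%E; last first.
  rewrite ge0_integralZl_EFin ?integral_normal_pdf ?mule1 //.
  - by move=> t _; rewrite lee_fin normal_pdf_ge0.
  - by apply/measurable_EFinP; exact: measurable_normal_pdf.
  - by rewrite exprn_ge0 // ltW // gauss_norm_gt0.
apply: eq_integral => t _.
transitivity (lebint (fun v : 'rV[R]_n =>
   (normal_fun (u0 0 0) (expR delta) t * gker (rsubmx (u0 : 'rV_(1 + n))) (prec delta) v)%:E)).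
  congr lebint; apply/funext => v; congr EFin.
  rewrite /gker sqnorm_row_cons /normal_fun -expRD; congr expR.
  rewrite mulrDr opprD; congr (_ - _).
  rewrite /prec expRN (_ : expR (2 * delta) = expR delta ^+ 2).
    by rewrite mulr2n; field.
  by rewrite expr2 -expRD; congr expR; ring.
rewrite lebintZ ?IH.
- rewrite normal_pdfE // peak -EFinM -EFinM; congr EFin.
  by rewrite exprS; field.
- exact: normal_fun_ge0.
- exact: continuous_gker.
- by move=> v; exact: expR_ge0.
Qed.

(** Every positive [b] is the precision of some delta, so the Gaussian integral computed at
    [prec delta] gives integrability of all kernels. *)
Lemma precK b : 0 < b -> prec (- ln (2 * b) / 2) = b.
Proof.
move=> b0; rewrite /prec (_ : - (2 * _) = ln (2 * b)); last by field.
by rewrite lnK ?posrE ?mulr_gt0 // mulrAC divff ?mul1r.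
Qed.

Lemma tempered1 n (u0 : 'rV[R]_n) : tempered u0 (fun=> 1).
Proof.
split; [exact: cst_continuous | by move=> v; exact: ler01 | move=> b b0].
rewrite (_ : (fun v => _) = gker u0 b); last by apply/funext => v; rewrite mul1r.
split; first exact: continuous_gker.
  by move=> v; exact: expR_ge0.
by rewrite -(precK b0) lebint_gker ltry.
Qed.

Lemma gtransf1 n (u0 : 'rV[R]_n) delta :
  gtransf u0 (fun=> 1) (prec delta) = gauss_norm delta ^+ n.
Proof.
rewrite /gtransf /rlebint -[RHS]/(fine (gauss_norm delta ^+ n)%:E) -(lebint_gker u0).
by congr (fine (lebint _)); apply/funext => v /=; rewrite mul1r.
Qed.

Lemma tempered_r2 n (u0 : 'rV[R]_n) : tempered u0 (fun v => sqnorm (v - u0)).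
Proof.
by have := temperedM_r2 (tempered1 u0); under [X in tempered _ X]eq_fun do rewrite mul1r.
Qed.

(* Differentiating the Gaussian integral in delta evaluates its second moment. *)
Lemma gtransf_r2 n (u0 : 'rV[R]_n) delta :
  2 * prec delta * gtransf u0 (fun v => sqnorm (v - u0)) (prec delta) =
  n%:R * gauss_norm delta ^+ n.
Proof.
have := is_derive_gtransf_prec delta (tempered1 u0).
under [X in gtransf _ X (prec delta)]eq_fun do rewrite mul1r.
move=> H1.
have E : gtransf u0 (fun=> 1) \o prec = (fun t => gauss_norm t ^+ n).
  by apply/funext => t /=; exact: gtransf1.
rewrite E in H1.
have H2 := is_derive_gauss_normX n delta.
by rewrite -(@derive_val _ _ _ _ _ _ _ H1) (@derive_val _ _ _ _ _ _ _ H2).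
Qed.
End laplace.

(** * Concentration as delta tends to -oo *)

Section laplace_limit.
Context {R : realType} (n : nat) (u0 : 'rV[R]_n).

(** The integral is split at squared distance [eta]. Inside, q differs from q(u0) by at most [e].
    Outside, the difference is at most q + q(u0), and r >= eta with b >= 2 give b r >= eta b / 2 +
    r, so the tail is exponentially small without any global bound on q. *)
Lemma gtransf_near_bound (q w : 'rV[R]_n -> R) (e eta b : R) :
  (forall v, 0 <= q v) -> tempered u0 w -> tempered u0 (fun v => q v * w v) ->
  0 <= e -> (forall v, sqnorm (v - u0) < eta -> `|q v - q u0| <= e) ->
  2 <= b ->
  `|gtransf u0 (fun v => q v * w v) b - q u0 * gtransf u0 w b| <=
  e * gtransf u0 w b +
  expR (- (eta / 2 * b)) * gtransf u0 (fun v => q v * w v + q u0 * w v) 1.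
Proof.
move=> q0 Tw Tqw e0 qe b2; have b0 : 0 < b by lra.
have [_ w0 Iw] := Tw; have [_ _ Iqw] := Tqw.
have [_ _ Is] := temperedD Tqw (temperedZ (q0 u0) Tw).
rewrite /gtransf.
set A := (fun v => q v * w v * gker u0 b v).
set B := (fun v => w v * gker u0 b v).
set C := (fun v => (q v * w v + q u0 * w v) * gker u0 1 v).
set E := expR _.
have E0 : 0 <= E by exact: expR_ge0.
have IA : nnc_integrable A by exact: Iqw.
have IB : nnc_integrable B by exact: Iw.
have IC : nnc_integrable C by exact: Is.
have key v : `|A v - q u0 * B v| <= e * B v + E * C v.
  have K0 : 0 <= gker u0 b v by exact: expR_ge0.
  have K1 : 0 <= gker u0 1 v by exact: expR_ge0.
  have qv := q0 v; have qu := q0 u0; have wv := w0 v.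
  have -> : A v - q u0 * B v = (q v - q u0) * B v by rewrite /A /B; ring.
  have B0 : 0 <= B v by rewrite mulr_ge0.
  have C0 : 0 <= C v by rewrite mulr_ge0 // addr_ge0 // mulr_ge0.
  rewrite normrM (ger0_norm B0).
  have [re|re] := ltP (sqnorm (v - u0)) eta.
    apply: (le_trans (ler_wpM2r B0 (qe _ re))).
    by rewrite lerDl mulr_ge0.
  (* Half of the decay pays for E, the other half for the kernel at b = 1. *)
  have KE : gker u0 b v <= E * gker u0 1 v.
    by have r0 := sqnorm_ge0 (v - u0); rewrite /E /gker -expRD ler_expR; nra.
  apply: (@le_trans _ _ (E * C v)); last by rewrite lerDr mulr_ge0.
  have -> : E * C v = (q v + q u0) * (w v * (E * gker u0 1 v)) by rewrite /C; ring.
  apply: ler_pM => //; last by rewrite ler_wpM2l.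
  by rewrite ler_norml; lra.
have IeB : nnc_integrable (fun v => e * B v) by exact: nnc_integrableZ.
have IqB : nnc_integrable (fun v => q u0 * B v) by exact: nnc_integrableZ.
have IEC : nnc_integrable (fun v => E * C v) by exact: nnc_integrableZ.
have IeE : nnc_integrable (fun v => e * B v + E * C v) by exact: nnc_integrableD.
have l1 : rlebint A <= q u0 * rlebint B + (e * rlebint B + E * rlebint C).
  rewrite -!rlebintZ // -!rlebintD //.
  apply: le_rlebint => // [|v]; first exact: nnc_integrableD.
  by have := key v; rewrite ler_norml => /andP[]; lra.
have l2 : q u0 * rlebint B <= rlebint A + (e * rlebint B + E * rlebint C).
  rewrite -!rlebintZ // -!rlebintD //.
  apply: le_rlebint => // [|v]; first exact: nnc_integrableD.
  by have := key v; rewrite ler_norml => /andP[]; lra.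
by rewrite ler_norml; apply/andP; split; lra.
Qed.

(** Balls of row vectors are those of the sup norm, while the kernel sees the Euclidean norm. Each
    coordinate is dominated by the latter, so [eta] is the square of the sup-norm radius. *)
Lemma continuous_sqnorm_near (q : 'rV[R]_n -> R) (e : R) : continuous q -> 0 < e ->
  exists2 eta, 0 < eta & forall v, sqnorm (v - u0) < eta -> `|q v - q u0| <= e.
Proof.
move=> cq e0; have /cvgrPdist_le/(_ _ e0)/nbhs_ballP[r r0 rq] := cq u0.
have {}r0 : 0 < r := r0.
exists (r ^+ 2); first by rewrite exprn_gt0.
move=> v vr; rewrite distrC; apply: rq; split => // i j.
rewrite -ball_normE /ball_ /= distrC.
rewrite -[ltRHS](gtr0_norm r0) -ltr_sqr // !real_normK ?num_real //.
apply: le_lt_trans vr; rewrite (ord1 i) /sqnorm (bigD1 j) //= !mxE lerDl.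
by apply: sumr_ge0 => k _; exact: sqr_ge0.
Qed.

(** For delta <= 0, e^(- delta) >= - delta gives prec delta >= delta^2 / 2, and a quadratic
    eventually exceeds the linear - m delta; delta <= - 2 m / kappa suffices. *)
Lemma expR_prec_decay (kappa : R) (m : nat) : 0 < kappa ->
  \forall delta \near -oo, expR (- (kappa * prec delta)) <= expR (m%:R * delta).
Proof.
move=> k0; near=> delta.
have d0 : delta <= 0 by near: delta; exact: nbhs_ninfty_le (num_real _).
have dk : delta <= - (2 * m%:R / kappa) by near: delta; exact: nbhs_ninfty_le (num_real _).
have {}dk : 2 * m%:R <= - delta * kappa by rewrite -ler_pdivrMr // lerNr.
rewrite ler_expR /prec.
have -> : expR (- (2 * delta)) = expR (- delta) ^+ 2.
  by rewrite expr2 -expRD; congr expR; ring.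
have dE : (- delta) ^+ 2 <= expR (- delta) ^+ 2.
  by have := expR_ge1Dx (- delta); nra.
have := ler_wpM2l (ltW k0) dE; have : 0 <= - delta by lra.
by move=> /ler_wpM2r/(_ _ _ dk); nra.
Unshelve. all: by end_near. Qed.

(** Laplace's method for a general weight [w], applied below to 1 and to the squared distance. The
    exact size A e^(m delta) of the denominator is what the tail of [gtransf_near_bound] is compared
    with. *)
Lemma laplace_ratio (q w : 'rV[R]_n -> R) (A : R) (m : nat) :
  continuous q -> (forall v, 0 <= q v) ->
  tempered u0 w -> tempered u0 (fun v => q v * w v) -> 0 < A ->
  (forall delta, gtransf u0 w (prec delta) = A * expR (m%:R * delta)) ->
  gtransf u0 (fun v => q v * w v) (prec delta) / gtransf u0 w (prec delta)
    @[delta --> -oo] --> q u0.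
Proof.
move=> cq q0 Tw Tqw A0 Aw; apply/cvgrPdist_le => e e0.
have e20 : 0 < e / 2 by lra.
have [eta eta0 qe] := continuous_sqnorm_near cq e20.
set C := gtransf u0 (fun v => q v * w v + q u0 * w v) 1.
have C0 : 0 <= C by apply: gtransf_ge0; exact: temperedD Tqw (temperedZ _ Tw).
have A1 : 0 < e / 2 * A / (C + 1) by rewrite divr_gt0 ?mulr_gt0 // ltr_wpDl.
near=> delta.
have W0 : 0 < gtransf u0 w (prec delta) by rewrite Aw mulr_gt0 ?expR_gt0.
have b2 : 2 <= prec delta.
  have : delta <= - 2 by near: delta; exact: nbhs_ninfty_le (num_real _).
  by have := expR_ge1Dx (- (2 * delta)); rewrite /prec; lra.
have := gtransf_near_bound q0 Tw Tqw (ltW e20) qe b2.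
rewrite -/C; set W := gtransf u0 w _ in W0 *; set Q := gtransf u0 (fun v => q v * w v) _.
move=> H; rewrite distrC.
have -> : Q / W - q u0 = (Q - q u0 * W) / W by field; rewrite gt_eqF.
rewrite normrM normfV (gtr0_norm W0) ler_pdivrMr //; apply: (le_trans H).
(* The exponent is one more than the [m] of the denominator; the spare factor [expR delta] absorbs
   the constants C, A and e. *)
have dE : expR (- (eta / 2 * prec delta)) <= expR (m.+1%:R * delta).
  by near: delta; apply: expR_prec_decay; rewrite divr_gt0.
have dC : expR delta <= e / 2 * A / (C + 1).
  have : delta <= ln (e / 2 * A / (C + 1)) by near: delta; exact: nbhs_ninfty_le (num_real _).
  by rewrite -ler_expR lnK.
have {}dC : expR delta * C <= e / 2 * A.
  move: dC; rewrite ler_pdivlMr ?ltr_wpDl // => dC; apply: le_trans dC.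
  by rewrite ler_wpM2l ?expR_ge0 // lerDl.
have : expR (- (eta / 2 * prec delta)) * C <= e / 2 * W.
  apply: (le_trans (ler_wpM2r C0 dE)).
  have -> : expR (m.+1%:R * delta) = expR (m%:R * delta) * expR delta.
    by rewrite -expRD; congr expR; rewrite -natr1; ring.
  have -> : e / 2 * W = expR (m%:R * delta) * (e / 2 * A) by rewrite /W Aw; ring.
  by rewrite -[leLHS]mulrA ler_wpM2l ?expR_ge0.
lra.
Unshelve. all: by end_near. Qed.

End laplace_limit.

(** * Logarithmic derivative of the transform *)

Section log_derivative.
Context {R : realType} (n : nat) (u0 : 'rV[R]_n) (q : 'rV[R]_n -> R).
Hypotheses (Iq : nnc_integrable q) (qu0 : 0 < q u0).

Lemma gtransf_ratio1 :
  gtransf u0 q (prec delta) / gauss_norm delta ^+ n @[delta --> -oo] --> q u0.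
Proof.
have [cq q0 _] := Iq; have Tq := tempered_nnc_integrable u0 Iq.
have q1 : (fun v => q v * 1) = q by apply/funext => v; rewrite mulr1.
have A0 : 0 < Num.sqrt (2 * pi) ^+ n :> R.
  by rewrite exprn_gt0 // sqrtr_gt0 mulr_gt0 // pi_gt0.
have := @laplace_ratio R n u0 q (fun=> 1) _ n cq q0 (tempered1 u0) _ A0.
rewrite q1 => /(_ Tq) H; under eq_fun do rewrite -(gtransf1 u0).
by apply: H => delta; rewrite gtransf1 /gauss_norm exprMn -expRM_natl.
Qed.

(** Laplace's method with the squared distance as weight. Its own transform is n [gauss_norm]^n / (2
    prec), where 1 / (2 prec) = e^(2 delta): hence the exponent n + 2, and [0 < n] makes the
    constant A positive. *)
Lemma gtransf_ratio_r2 : (0 < n)%N ->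
  2 * prec delta * gtransf u0 (fun v => q v * sqnorm (v - u0)) (prec delta) /
  gauss_norm delta ^+ n @[delta --> -oo] --> n%:R * q u0.
Proof.
move=> n0; have [cq q0 _] := Iq.
have n0R : n%:R != 0 :> R by rewrite pnatr_eq0 -lt0n.
have A0 : 0 < n%:R * Num.sqrt (2 * pi) ^+ n :> R.
  by rewrite mulr_gt0 ?ltr0n // exprn_gt0 // sqrtr_gt0 mulr_gt0 // pi_gt0.
have H := @laplace_ratio R n u0 q (fun v => sqnorm (v - u0)) _ n.+2 cq q0
  (tempered_r2 u0) (temperedM_r2 (tempered_nnc_integrable u0 Iq)) A0.
have Gd delta : gtransf u0 (fun v => sqnorm (v - u0)) (prec delta) =
    n%:R * gauss_norm delta ^+ n / (2 * prec delta).
  by rewrite -(gtransf_r2 u0); field; rewrite gt_eqF // prec_gt0.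
pose G delta := gtransf u0 (fun v => q v * sqnorm (v - u0)) (prec delta).
have -> : (fun delta => 2 * prec delta * G delta / gauss_norm delta ^+ n) =
    (fun delta => n%:R * (G delta / gtransf u0 (fun v => sqnorm (v - u0)) (prec delta))).
  apply/funext => delta; rewrite Gd; field.
  by rewrite n0R !gt_eqF ?prec_gt0 ?exprn_gt0 ?gauss_norm_gt0.
apply: cvgM; first exact: cvg_cst.
apply: H => delta.
rewrite Gd /gauss_norm /prec exprMn -expRM_natl.
have -> : expR (n.+2%:R * delta) = expR (n%:R * delta) * expR (2 * delta).
  by rewrite -expRD; congr expR; rewrite -addn2 natrD; ring.
by rewrite expRN; field; rewrite gt_eqF ?expR_gt0.
Qed.

(** Positivity is read off the limit q(u0) > 0 of the normalised transform, hence holds only near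
    -oo. *)
Lemma gtransf_gt0_near : \forall delta \near -oo, 0 < gtransf u0 q (prec delta).
Proof.
have /cvgr_gt/(_ _ qu0) := gtransf_ratio1; apply: filterS => delta.
by rewrite pmulr_lgt0 // invr_gt0 exprn_gt0 // gauss_norm_gt0.
Qed.

Lemma gtransf_dlog_cvg : (0 < n)%N ->
  2 * prec delta * gtransf u0 (fun v => q v * sqnorm (v - u0)) (prec delta) /
  gtransf u0 q (prec delta) @[delta --> -oo] --> (n%:R : R).
Proof.
move=> n0; have q0 : q u0 != 0 by rewrite gt_eqF.
rewrite -[n%:R](mulfK q0).
(* The limit is n q(u0) times the inverse of q(u0); the powers of [gauss_norm] cancel in the
   product. *)
apply: cvg_trans (cvgM (gtransf_ratio_r2 n0) (cvgV q0 gtransf_ratio1)).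
apply: near_eq_cvg; near=> delta => /=; field.
apply/andP; split; rewrite gt_eqF //; first by near: delta; exact: gtransf_gt0_near.
by rewrite exprn_gt0 // gauss_norm_gt0.
Unshelve. all: by end_near. Qed.

End log_derivative.

(** * Pullback to the parameter space *)

Section affine_subspace.
Context {R : realType} (d D : nat) (a : 'rV[R]_D) (U : 'M[R]_(d, D)).

Lemma continuous_affine_param : continuous (fun u : 'rV[R]_d => a + u *m U).
Proof.
move=> u A /= /nbhs_ballP[e e0 eA].
have cij j : continuous (fun u : 'rV[R]_d => (a + u *m U) 0 j).
  rewrite [X in continuous X](_ : _ =
      fun u : 'rV[R]_d => a 0 j + \sum_k u 0 k * U k j); last first.
    by apply/funext => v; rewrite !mxE.
  have cs : continuous (fun u : 'rV[R]_d => \sum_k u 0 k * U k j).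
    apply: continuous_big => [|k _ v]; first exact: add_continuous.
    exact: (cvgM (@coord_continuous _ _ _ 0 k v) (cvg_cst (U k j))).
  by move=> v; exact: (cvgD (cvg_cst (a 0 j)) (cs v)).
have /filter_forall : forall j, \forall v \near u,
    ball ((a + u *m U) 0 j) e ((a + v *m U) 0 j).
  by move=> j; apply: (cij j u); exact: nbhsx_ballx.
by apply: filterS => v uv; apply: eA; split => // i j; rewrite (ord1 i).
Qed.

(** The parametrization takes values in the subspace, so continuity of [p] along the subspace alone
    yields continuity on the whole parameter space. *)
Lemma continuous_affine_pullback (p : 'rV[R]_D -> R) :
  {within affsub a U, continuous p} -> continuous (fun u : 'rV[R]_d => p (a + u *m U)).
Proof.
move=> /subspace_continuousP cp u.
have /cp : affsub a U (a + u *m U) by exists u.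
apply: cvg_trans => A nA.
apply: (@filterS _ (nbhs (u : 'rV[R]_d)) _ _ _ _ (@continuous_affine_param u _ nA)).
by move=> v; apply; exists v.
Qed.

Hypothesis UUT : U *m U^T = 1%:M.

Lemma sqnormE m (y : 'rV[R]_m) : sqnorm y = (y *m y^T) 0 0.
Proof. by rewrite mxE; apply: eq_bigr => i _; rewrite mxE expr2. Qed.

Lemma sqnorm_isometry (u : 'rV[R]_d) : sqnorm (u *m U) = sqnorm u.
Proof. by rewrite !sqnormE trmx_mul mulmxA -(mulmxA u) UUT mulmx1. Qed.

(** The isometry turns the ambient Gaussian into the kernel on the parameter space; the ambient
    dimension survives only as the power D of the normaliser. *)
Lemma rho_gtransf (p : 'rV[R]_D -> R) (u0 : 'rV[R]_d) (delta : R) :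
  nnc_integrable (fun u : 'rV[R]_d => p (a + u *m U)) ->
  rho a U p (a + u0 *m U) delta =
  (gauss_norm delta ^+ D)^-1 * gtransf u0 (fun u : 'rV[R]_d => p (a + u *m U)) (prec delta).
Proof.
move=> Ip; have [_ _ Iq] := tempered_nnc_integrable u0 Ip.
have g0 : 0 <= (gauss_norm delta ^+ D)^-1.
  by rewrite invr_ge0 exprn_ge0 // ltW // gauss_norm_gt0.
rewrite /gtransf -rlebintZ //; last exact/Iq/prec_gt0.
rewrite /rho /Lint /rlebint; congr (fine (lebint _)); apply/funext => u /=.
congr EFin; rewrite /gauss -/(gauss_norm delta) mulrCA; congr (_ * (_ * _)).
rewrite /gker; congr expR.
have -> : a + u0 *m U - (a + u *m U) = (- (u - u0)) *m U.
  by rewrite opprB mulmxBl opprD addrACA subrr add0r.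
rewrite sqnorm_isometry /prec expRN.
have -> : sqnorm (- (u - u0)) = sqnorm (u - u0).
  by apply: eq_bigr => i _; rewrite [in LHS]mxE sqrrN.
by field; rewrite gt_eqF // expR_gt0.
Qed.

End affine_subspace.

(** * Limit of the logarithmic derivative of [rho] *)

Theorem theorem3p1 (R : realType) (d D : nat) (a : 'rV[R]_D) (U : 'M[R]_(d, D))
  (p : 'rV[R]_D -> R) (x : 'rV[R]_D) :
  (1 <= d)%N -> (d <= D)%N ->
  U *m U^T = 1%:M ->
  (forall x0, affsub a U x0 -> 0 <= p x0) ->
  {within affsub a U, continuous p} ->
  Lint a U (fun x0 => (p x0)%:E) = 1%E ->
  (Lint a U (fun x0 => (sqnorm x0 * p x0)%:E) < +oo)%E ->
  affsub a U x -> 0 < p x ->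
  (\forall delta \near -oo, derivable (fun t => ln (rho a U p x t)) delta 1) /\
  (derive1 (fun t => ln (rho a U p x t)) delta @[delta --> -oo] --> (d%:R - D%:R : R)).
Proof.
move=> d1 _ UUT p0 cp p1 _ [u0 _ <-] px.
pose q (u : 'rV[R]_d) := p (a + u *m U).
have Iq : nnc_integrable q.
  split; first exact: continuous_affine_pullback.
    by move=> u; apply: p0; exists u.
  (* Integrability of the pulled-back density comes from its total mass 1. *)
  by rewrite [lebint _]p1 ltry.
pose G t := gtransf u0 q (prec t).
pose H t := 2 * prec t * gtransf u0 (fun v => q v * sqnorm (v - u0)) (prec t).
(* The normaliser contributes - D and the transform H / G; positivity of G t lets [ln] be
   differentiated there. *)
have der t : 0 < G t ->
    is_derive t 1 (fun t => ln (rho a U p (a + u0 *m U) t)) (H t / G t - D%:R).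
  move=> Gt0.
  have -> : (fun t => ln (rho a U p (a + u0 *m U) t)) =
      @ln R \o (fun t => (gauss_norm t ^+ D)^-1 * G t).
    by apply/funext => s /=; rewrite rho_gtransf.
  have gt0 : gauss_norm t ^+ D > 0 by rewrite exprn_gt0 // gauss_norm_gt0.
  have dG : is_derive t 1 G (H t).
    exact: is_derive_gtransf_prec (tempered_nnc_integrable u0 Iq).
  have dg : is_derive t 1 (fun t => (gauss_norm t ^+ D)^-1)
      (- D%:R * (gauss_norm t ^+ D)^-1).
    have dgn := is_derive_gauss_normX D t.
    have gn0 : gauss_norm t ^+ D != 0 by rewrite gt_eqF.
    apply: DeriveDef; first exact/derivableV/(@ex_derive _ _ _ _ _ _ _ dgn).
    rewrite deriveV ?(@derive_val _ _ _ _ _ _ _ dgn) //.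
    by rewrite /GRing.scale /=; field.
  have dp := is_deriveM dg dG.
  have Gg0 : 0 < (gauss_norm t ^+ D)^-1 * G t by rewrite mulr_gt0 ?invr_gt0.
  have dl := @is_derive1_comp _ (@ln R) (fun t => (gauss_norm t ^+ D)^-1 * G t) t _ _
    (is_derive1_ln Gg0) dp.
  apply: is_derive_eq.
  rewrite /GRing.scale /=; field.
  by rewrite !gt_eqF.
have near0 := gtransf_gt0_near Iq px.
split.
  by apply: filterS near0 => t /der/@ex_derive.
have lim : H t / G t - D%:R @[t --> -oo] --> (d%:R - D%:R : R).
  exact: (cvgB (gtransf_dlog_cvg Iq px d1) (cvg_cst (D%:R : R))).
apply: cvg_trans lim.
(* The formula for the derivative is available only where G is positive, that is eventually, which
   is enough for the limit. *)
apply: near_eq_cvg; apply: filterS near0 => t /der dt.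
by rewrite derive1E derive_val.
Qed.
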